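(* For a variety of groups $\mathcal V$ let $\mathrm{Id}(\mathcal V)\le\mathbb F_\infty$ be the (fully characteristic) subgroup of all identical relations holding in every group of $\mathcal V$. If $\mathcal V$ contains a nontrivial group, then $\mathrm{Id}(\mathcal V)$ is a proper $S$-invariant subgroup of $\mathbb F_\infty$, and the assignment $\mathcal V\mapsto\mathcal C_{\mathcal V}:=F^{-1}(\mathrm{Id}(\mathcal V))$ (using the identification $E\cong\mathbb F_\infty$, $x_k=a_1a_{k+1}$) is an injective, order-reversing lattice embedding of the lattice of varieties of groups containing a nontrivial group into the lattice of simplifiable hyperoctahedral categories of partitions: $\mathcal V_1\subseteq\mathcal V_2$ iff $\mathcal C_{\mathcal V_1}\supseteq\mathcal C_{\mathcal V_2}$. Consequently, composing with the (inclusion-reversing) correspondence between categories of partitions and easy quantum groups, one obtains a lattice injection of these varieties of groups into the lattice of simplifiable hyperoctahedral easy quantum groups.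
   Context: A partition $p\in P(k,l)$ is a partition of $k$ ordered upper and $l$ ordered lower points into blocks; a category of partitions is a subset of $P=\bigcup P(k,l)$ containing the pair partition and the identity partition and closed under tensor product, composition, involution and rotation. A category $\mathcal C$ is simplifiable hyperoctahedral if it contains the four block $b_4\in P(0,4)$ (one block of four points) and the pair positioner $\rho\in P(3,3)$ (blocks $\{1,2,2',3'\}$, $\{3,1'\}$) but not the double singleton $\uparrow\otimes\uparrow\in P(0,2)$ (two one-point blocks). Easy quantum groups correspond bijectively to categories of partitions, larger categories giving smaller quantum groups; a simplifiable hyperoctahedral easy quantum group is one whose category is simplifiable hyperoctahedral. $G=\mathbb Z_2^{*\infty}$ with generators $a_1,a_2,\dots$; for a partition $p$ and a labelling $\ell$ of its blocks by pairwise distinct $a_i$, $w(p,\ell)$ is the word read starting at the leftmost upper point, through the upper row left to right, then the lower row right to left, and $F(\mathcal C)$ is the set of images in $G$ of all $w(p,\ell)$, $p\in\mathcal C$. $E\le G$ is the subgroup of even-length elements, free on $x_k=a_1a_{k+1}$. $F$ is a lattice isomorphism from simplifiable hyperoctahedral categories onto proper $S$-invariant subgroups of $\mathbb F_\infty\cong E$, where $S\subseteq\mathrm{End}(\mathbb F_\infty)$ is generated by: finite identifications $x_k\mapsto x_{i(k)}$ ($k\le n$), $x_k\mapsto x_k$ ($k>n$); for each $i$, $x_k\mapsto x_i^{-1}x_k$ for all $k$; for each $k$, $x_k\mapsto e$ fixing the other generators; $x_k\mapsto x_k^{-1}$ for all $k$; all inner automorphisms. A word $w(x_1,\dots,x_n)\in\mathbb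 F_\infty$ is an identical relation of a group $\Gamma$ if $w(g_1,\dots,g_n)=1$ for all $g_1,\dots,g_n\in\Gamma$. A variety of groups is the class of all groups satisfying a given set of identical relations. A subgroup of $\mathbb F_\infty$ is fully characteristic if it is invariant under all endomorphisms of $\mathbb F_\infty$. *)

(* Defs.v *)
From mathcomp Require Import all_boot.
Set Implicit Arguments. Unset Strict Implicit. Unset Printing Implicit Defensive.

(* A partition p in P(k,l): k upper points (indices 0..k-1, left to right)
   and l lower points (indices k..k+l-1, left to right).  [plab p] gives a
   block label for each point; well-formed partitions use the canonical
   labelling "label of a point = smallest index of a point in its block". *)
Record part := Part { pk : nat; pl : nat; plab : seq nat }.

Definition canon (n : nat) (f : nat -> nat) : seq nat :=
  [seq find (fun j => f j == f i) (iota 0 n) | i <- iota 0 n].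

Definition mkpart (k l : nat) (f : nat -> nat) : part := Part k l (canon (k + l) f).

Definition lab (p : part) (i : nat) : nat := nth 0 (plab p) i.

Definition wf_part (p : part) : bool :=
  plab p == canon (pk p + pl p) (lab p).

Definition ptensor (p q : part) : part :=
  let k1 := pk p in let l1 := pl p in let k2 := pk q in let l2 := pl q in
  mkpart (k1 + k2) (l1 + l2) (fun i =>
    if i < k1 then (lab p i).*2
    else if i < k1 + k2 then (lab q (i - k1)).*2.+1
    else if i < k1 + k2 + l1 then (lab p (i - k2)).*2
    else (lab q (i - k1 - l1)).*2.+1).

Definition pinv (p : part) : part :=
  mkpart (pl p) (pk p) (fun i =>
    if i < pl p then lab p (pk p + i) else lab p (i - pl p)).

(* leftmost upper point becomes leftmost lower point (needs k >= 1) *)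
Definition rotUL (p : part) : part :=
  let k := pk p in
  mkpart k.-1 (pl p).+1 (fun i =>
    if i < k.-1 then lab p i.+1 else if i == k.-1 then lab p 0 else lab p i).
(* leftmost lower point becomes leftmost upper point (needs l >= 1) *)
Definition rotLU (p : part) : part :=
  let k := pk p in
  mkpart k.+1 (pl p).-1 (fun i =>
    if i == 0 then lab p k else if i < k.+1 then lab p i.-1 else lab p i).
(* rightmost upper point becomes rightmost lower point (needs k >= 1) *)
Definition rotUR (p : part) : part :=
  let k := pk p in let l := pl p in
  mkpart k.-1 l.+1 (fun i =>
    if i < k.-1 then lab p i else if i < k.-1 + l then lab p i.+1 else lab p k.-1).
(* rightmost lower point becomes rightmost upper point (needs l >= 1) *)
Definition rotLR (p : part) : part :=
  let k := pk p in let l := pl p in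
  mkpart k.+1 l.-1 (fun i =>
    if i < k then lab p i else if i == k then lab p (k + l).-1 else lab p i.-1).

(* composition q p (p on top of q), for p in P(k,l), q in P(l,m): the lower
   points of p are identified with the upper points of q, blocks are joined,
   middle points (and closed loops) are removed. Vertices: 0..k-1 upper of p,
   k..k+l-1 middle, k+l..k+l+m-1 lower of q (plus one isolated dummy). *)
Definition pcomp (p q : part) : part :=
  let k := pk p in let l := pl p in let m := pl q in
  let N := k + l + m in
  let r := [rel x y : 'I_N.+1 |
      ((x < k + l) && (y < k + l) && (lab p x == lab p y))
      || [&& k <= x, k <= y, x < N, y < N & lab q (x - k) == lab q (y - k)]] in
  let outer i := if i < k then i else i + l in
  mkpart k m (fun i =>
    find (fun j => connect r (inord (outer i)) (inord j)) (iota 0 N.+1)).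

Definition pair_part : part := Part 0 2 [:: 0; 0].
Definition id_part : part := Part 1 1 [:: 0; 0].
Definition b4 : part := Part 0 4 [:: 0; 0; 0; 0].
Definition rho : part := Part 3 3 [:: 0; 0; 2; 2; 0; 0].
Definition dsing : part := Part 0 2 [:: 0; 1].

Definition category (C : part -> Prop) : Prop :=
  (forall p, C p -> wf_part p) /\
  C pair_part /\ C id_part /\
  (forall p q, C p -> C q -> C (ptensor p q)) /\
  (forall p q, C p -> C q -> pl p = pk q -> C (pcomp p q)) /\
  (forall p, C p -> C (pinv p)) /\
  (forall p, C p ->
      (0 < pk p -> C (rotUL p) /\ C (rotUR p)) /\
      (0 < pl p -> C (rotLU p) /\ C (rotLR p))).

Definition simp_hyperoct (C : part -> Prop) : Prop :=
  [/\ category C, C b4, C rho & ~ C dsing].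

(* ============ G = Z_2^{*oo}, generators a_0, a_1, ... ============ *)
(* elements = reduced words in the letters (no two equal adjacent letters) *)
Definition gred (s : seq nat) : seq nat :=
  foldr (fun a t => if t is b :: t' then (if a == b then t' else a :: t) else [:: a])
        [::] s.

Definition pword (p : part) (ell : nat -> nat) : seq nat :=
  [seq ell (lab p i) | i <- iota 0 (pk p) ++ rev (iota (pk p) (pl p))].

Definition block_inj (p : part) (ell : nat -> nat) : Prop :=
  forall i j, i < pk p + pl p -> j < pk p + pl p ->
    ell (lab p i) = ell (lab p j) -> lab p i = lab p j.

Definition FC (C : part -> Prop) (g : seq nat) : Prop :=
  exists p ell, [/\ C p, block_inj p ell & g = gred (pword p ell)].

(* letter (k,false) = x_k, (k,true) = x_k^{-1}; elements = reduced words *)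
Definition fred (s : seq (nat * bool)) : seq (nat * bool) :=
  foldr (fun a t => if t is b :: t' then
                      (if (a.1 == b.1) && (a.2 != b.2) then t' else a :: t)
                    else [:: a]) [::] s.
Definition freduced (w : seq (nat * bool)) : bool := fred w == w.
Definition fmul (u v : seq (nat * bool)) := fred (u ++ v).
Definition finv (u : seq (nat * bool)) := rev [seq (a.1, ~~ a.2) | a <- u].
Definition gen (k : nat) : seq (nat * bool) := [:: (k, false)].
Definition fsubst (sigma : nat -> seq (nat * bool)) (w : seq (nat * bool)) :=
  fred (flatten [seq if a.2 then finv (sigma a.1) else sigma a.1 | a <- w]).

Definition fsubgroup (H : seq (nat * bool) -> Prop) : Prop :=
  [/\ (forall w, H w -> freduced w), H [::],
      (forall u v, H u -> H v -> H (fmul u v)) &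
      (forall u, H u -> H (finv u))].

Definition fproper (H : seq (nat * bool) -> Prop) : Prop :=
  exists w, freduced w /\ ~ H w.

(* invariance under the generators of the semigroup S *)
Definition S_invariant (H : seq (nat * bool) -> Prop) : Prop :=
  fsubgroup H /\
  (forall n (i : nat -> nat) w, H w ->
      H (fsubst (fun k => if k < n then gen (i k) else gen k) w)) /\
  (forall i w, H w -> H (fsubst (fun k => fmul (finv (gen i)) (gen k)) w)) /\
  (forall k0 w, H w -> H (fsubst (fun k => if k == k0 then [::] else gen k) w)) /\
  (forall w, H w -> H (fsubst (fun k => finv (gen k)) w)) /\
  (forall u w, freduced u -> H w -> H (fmul (fmul u w) (finv u))).

(* the identification F_oo = E <= G, x_k |-> a_0 a_{k+1} *)
Definition phi (w : seq (nat * bool)) : seq nat :=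
  gred (flatten [seq if a.2 then [:: a.1.+1; 0] else [:: 0; a.1.+1] | a <- w]).

Record group := Group {
  gcar :> Type;
  gmul : gcar -> gcar -> gcar;
  ginv : gcar -> gcar;
  gone : gcar;
  gmulA : forall x y z, gmul x (gmul y z) = gmul (gmul x y) z;
  gmul1 : forall x, gmul gone x = x;
  gmulV : forall x, gmul (ginv x) x = gone }.

Definition geval (G : group) (g : nat -> G) (w : seq (nat * bool)) : G :=
  foldr (fun a acc => gmul (if a.2 then ginv (g a.1) else g a.1) acc) (gone G) w.

Definition identical (w : seq (nat * bool)) (G : group) : Prop :=
  forall g : nat -> G, geval g w = gone G.

Definition variety (V : group -> Prop) : Prop :=
  exists W : seq (nat * bool) -> Prop,
    forall G, V G <-> (forall w, W w -> identical w G).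

Definition nontrivialV (V : group -> Prop) : Prop :=
  exists G, V G /\ exists x : gcar G, x <> gone G.

Definition IdV (V : group -> Prop) (w : seq (nat * bool)) : Prop :=
  freduced w /\ forall G, V G -> identical w G.

(* C is the category C_V = F^{-1}(Id V) *)
Definition is_CV (V : group -> Prop) (C : part -> Prop) : Prop :=
  simp_hyperoct C /\ (forall g, FC C g <-> exists w, IdV V w /\ g = phi w).

(* join (smallest variety containing both) and meet (intersection) *)
Definition vjoin (V1 V2 : group -> Prop) (G : group) : Prop :=
  forall w, IdV V1 w -> IdV V2 w -> identical w G.
Definition vmeet (V1 V2 : group -> Prop) (G : group) : Prop := V1 G /\ V2 G.

(* Main.v *)
From Stdlib Require Import ClassicalEpsilon.
From Stdlib Require Import FunctionalExtensionality PropExtensionality.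
From mathcomp Require Import all_boot zify.
Require Import Defs.
Set Implicit Arguments.
Unset Strict Implicit.
Unset Printing Implicit Defensive.

(** Partitions are handled through their words.  A family [y] in a group [G]
    makes the free product of copies of Z_2 act on [G * bool] by involutions,
    and an even word acts trivially for all [y] iff the alternating product
    y_{i1}^-1 y_{i2} y_{i3}^-1 ... is an identity of [G]; since y_0 may be
    normalised to 1, these are the words of Id(V) under x_k = a_0 a_{k+1}.  The
    partitions whose word acts trivially for all [G] in [V] form C_V.

    Conversely, in a category containing b_4 and the pair positioner, a pair
    [a a] can be deleted from a word (capping), inserted next to an [a] (b_4), and
    moved anywhere (pair positioner).  Membership therefore only depends on
    the reduced word, so such a category is determined by its image under F.

    For the meet, the words of such a category D form a normal subgroup; if D
    contains C_{V1} and C_{V2}, the quotient of the free group by it lies in both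
    varieties, so every identity of their intersection has its word in D. *)

(** * Partitions and their words *)

Section Mkpart.
Variables (k l : nat).
Implicit Types f g : nat -> nat.

Lemma lab_mkpart f i : i < k + l ->
  lab (mkpart k l f) i = find (fun j => f j == f i) (iota 0 (k + l)).
Proof. by move=> lti; rewrite /lab /= (nth_map 0) ?size_iota // nth_iota. Qed.

Lemma find_iota_eq f i n : i < n ->
  f (find (fun j => f j == f i) (iota 0 n)) = f i.
Proof.
move=> lti; have hP : has (fun j => f j == f i) (iota 0 n).
  by apply/hasP; exists i => //; rewrite mem_iota.
have := nth_find 0 hP; rewrite nth_iota => [/eqP //|].
by rewrite -[n in _ < n](size_iota 0 n) -has_find.
Qed.

Lemma lab_mkpart_eq f i j : i < k + l -> j < k + l ->
  (lab (mkpart k l f) i == lab (mkpart k l f) j) = (f i == f j).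
Proof.
move=> lti ltj; rewrite !lab_mkpart //; apply/eqP/eqP => [e|->] //.
by rewrite -(find_iota_eq f lti) e find_iota_eq.
Qed.

(** The canonical labelling depends only on the kernel of the labelling function, so equality of
    partitions reduces to comparing kernels. *)
Lemma eq_mkpart f g :
  (forall i j, i < k + l -> j < k + l -> (f i == f j) = (g i == g j)) ->
  mkpart k l f = mkpart k l g.
Proof.
move=> efg; congr Part; apply/eq_in_map => i; rewrite mem_iota /= add0n => lti.
by apply: eq_in_find => j; rewrite mem_iota /= add0n => ltj; apply: efg.
Qed.

Lemma mkpart_wf f : wf_part (mkpart k l f).
Proof.
apply/eqP; apply: (congr1 plab (@eq_mkpart f (lab (mkpart k l f)) _)).
by move=> i j lti ltj; rewrite lab_mkpart_eq.
Qed.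

End Mkpart.

Lemma wf_mkpart p : wf_part p -> p = mkpart (pk p) (pl p) (lab p).
Proof. by case: p => k l s /eqP /= e; rewrite /mkpart -e. Qed.

Definition row_order (k l : nat) : seq nat := iota 0 k ++ rev (iota k l).

(** The reflection of the lower row [k..n-1]. As an involution it serves both to turn points into
    word positions and to go back. *)
Definition wpos (k n i : nat) : nat := if i < k then i else n + k - i.+1.

Lemma size_row_order k l : size (row_order k l) = k + l.
Proof. by rewrite size_cat size_rev !size_iota. Qed.

Lemma nth_row_order k l i : i < k + l ->
  nth 0 (row_order k l) i = wpos k (k + l) i.
Proof.
move=> lti; rewrite nth_cat size_iota /wpos; case: ltnP => lik.
  by rewrite nth_iota.
rewrite nth_rev ?size_iota; last by lia.
by rewrite nth_iota; lia.
Qed.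

Lemma mem_row_order k l i : (i \in row_order k l) = (i < k + l).
Proof. by rewrite mem_cat mem_rev !mem_iota; lia. Qed.

Lemma wposK k n i : i < n -> k <= n -> wpos k n (wpos k n i) = i.
Proof. by rewrite /wpos; do 2![case: ifP]; lia. Qed.

Lemma wpos_lt k n i : i < n -> k <= n -> wpos k n i < n.
Proof. by rewrite /wpos; case: ifP; lia. Qed.

(* The partition with [k] upper points whose word (upper row left to right,
   then lower row right to left) is [u]. *)
Definition wpart (k : nat) (u : seq nat) : part :=
  mkpart k (size u - k) (fun i => nth 0 u (wpos k (size u) i)).

(** Equality of words up to an injective renaming of the letters that occur. *)
Definition same_ker (u v : seq nat) : Prop :=
  size u = size v /\ forall i j, i < size u -> j < size u ->
    (nth 0 u i == nth 0 u j) = (nth 0 v i == nth 0 v j).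

Lemma wpart_ker k u v : k <= size u -> same_ker u v -> wpart k u = wpart k v.
Proof.
move=> leku [es ek]; rewrite /wpart -es; apply: eq_mkpart => i j lti ltj.
by rewrite ek // wpos_lt //; lia.
Qed.

Lemma same_ker_map (f g : nat -> nat) s :
  {in s &, forall x y, (f x == f y) = (g x == g y)} ->
  same_ker (map f s) (map g s).
Proof.
move=> efg; split; first by rewrite !size_map.
move=> i j; rewrite size_map => lti ltj.
by rewrite !(nth_map 0) // efg // mem_nth.
Qed.

Lemma pwordE p ell :
  pword p ell = map (fun i => ell (lab p i)) (row_order (pk p) (pl p)).
Proof. by []. Qed.

Lemma wpart_row_order k l f :
  wpart k (map f (row_order k l)) = mkpart k l f.
Proof.
rewrite /wpart size_map size_row_order addKn; apply: eq_mkpart => i j lti ltj.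
by rewrite !(nth_map 0) ?size_row_order ?wpos_lt ?leq_addr // !nth_row_order
  ?wpos_lt ?leq_addr // !wposK ?leq_addr.
Qed.

Lemma wpart_pword p ell : wf_part p -> block_inj p ell ->
  wpart (pk p) (pword p ell) = p.
Proof.
move=> wfp inj; rewrite pwordE wpart_row_order [RHS]wf_mkpart //.
apply: eq_mkpart => i j lti ltj; apply/eqP/eqP => [/inj -> //|-> //].
Qed.

Lemma size_pword p ell : size (pword p ell) = pk p + pl p.
Proof. by rewrite pwordE size_map size_row_order. Qed.

Lemma pword_id p : pword p id = map (lab p) (row_order (pk p) (pl p)).
Proof. by []. Qed.

Lemma lab_wpart_eq k u i j : k <= size u -> i < size u -> j < size u ->
  (lab (wpart k u) i == lab (wpart k u) j) =
  (nth 0 u (wpos k (size u) i) == nth 0 u (wpos k (size u) j)).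
Proof. by move=> leku lti ltj; rewrite lab_mkpart_eq //; lia. Qed.

(** Common pattern of the rotations and the involution: each permutes points by some [g], and only
    an identity between word positions remains to be checked. *)
Lemma mkpart_wpart k k' u v (g : nat -> nat) l' :
  k <= size u -> size v = size u -> l' = size u - k' -> k' <= size u ->
  (forall i, i < size u -> g i < size u) ->
  (forall i, i < size u ->
     nth 0 u (wpos k (size u) (g i)) = nth 0 v (wpos k' (size u) i)) ->
  mkpart k' l' (fun i => lab (wpart k u) (g i)) = wpart k' v.
Proof.
move=> leku ev -> lek'u ltg eg; rewrite /wpart ev; apply: eq_mkpart.
move=> i j lti ltj; have {}lti : i < size u by lia.
have {}ltj : j < size u by lia.
by rewrite lab_wpart_eq ?ltg // !eg.
Qed.

(** The right ends of the two rows are adjacent in the word, so a right rotation only moves the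
    boundary between the rows. *)
Lemma rotUR_wpart k u : k < size u -> rotUR (wpart k.+1 u) = wpart k u.
Proof.
move=> ltku; rewrite /rotUR /=.
pose g i := if i < k then i else if i < k + (size u - k.+1) then i.+1 else k.
rewrite -(@mkpart_wpart k.+1 k u u g (size u - k.+1).+1) //; try lia.
- by apply: eq_mkpart => i j _ _; rewrite /g; do ![case: ifP => //].
- by move=> i; rewrite /g; do ![case: ifP]; lia.
- by move=> i; rewrite /g /wpos; do ![case: ifP]; move=> *; congr nth; lia.
Qed.

Lemma rotLR_wpart k u : k < size u -> rotLR (wpart k u) = wpart k.+1 u.
Proof.
move=> ltku; rewrite /rotLR /=.
pose g i := if i < k then i else if i == k then (k + (size u - k)).-1 else i.-1.
rewrite -(@mkpart_wpart k k.+1 u u g (size u - k).-1) //; try lia.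
- by apply: eq_mkpart => i j _ _; rewrite /g; do ![case: ifP => //].
- by move=> i; rewrite /g; do ![case: ifP]; lia.
- by move=> i; rewrite /g /wpos; do ![case: ifP]; move=> *; congr nth; lia.
Qed.

(** The left ends of the two rows are the first and the last letter of the word, so a left rotation
    is a cyclic shift. *)
Lemma rotUL_wpart k a u : k <= size u ->
  rotUL (wpart k.+1 (a :: u)) = wpart k (rcons u a).
Proof.
move=> ltku; rewrite /rotUL.
pose g i := if i < k then i.+1 else if i == k then 0 else i.
rewrite -(@mkpart_wpart k.+1 k (a :: u) (rcons u a) g
            ((size u).+1 - k.+1).+1) //=; try by rewrite ?size_rcons; lia.
- by apply: eq_mkpart => i j _ _; rewrite /g /=; do ![case: ifP => //].
- by move=> i; rewrite /g; do ![case: ifP]; lia.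
- move=> i lti; rewrite nth_rcons /g.
  have [ltik|] := ltnP i k.
    have -> : wpos k.+1 (size u).+1 i.+1 = i.+1 by rewrite /wpos ltnS ltik.
    have -> : wpos k (size u).+1 i = i by rewrite /wpos ltik.
    by rewrite /= ifT //; lia.
  case: eqP => [-> _ | ne le].
    have -> : wpos k (size u).+1 k = size u by rewrite /wpos ltnn; lia.
    by rewrite ltnn eqxx.
  have -> : wpos k.+1 (size u).+1 i = ((size u).+1 + k - i.+1).+1.
    by rewrite /wpos ifF; lia.
  have -> : wpos k (size u).+1 i = ((size u).+1 + k - i.+1).
    by rewrite /wpos ifF; lia.
  by rewrite /= ifT //; lia.
Qed.

Lemma rotLU_wpart k a u : k <= size u ->
  rotLU (wpart k (rcons u a)) = wpart k.+1 (a :: u).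
Proof.
move=> ltku; rewrite /rotLU.
pose g i := if i == 0 then k else if i < k.+1 then i.-1 else i.
have sz := size_rcons u a.
rewrite -(@mkpart_wpart k k.+1 (rcons u a) (a :: u) g ((size u).+1 - k).-1) //=;
  rewrite ?sz; try by lia.
- by apply: eq_mkpart => i j _ _; rewrite /g /=; do ![case: ifP => //].
- by move=> i; rewrite /g; do ![case: ifP]; lia.
- move=> i lti; rewrite nth_rcons /g.
  case: eqP => [->|/eqP i0].
    have -> : wpos k (size u).+1 k = size u by rewrite /wpos ltnn; lia.
    by rewrite ltnn eqxx.
  have [ik|ik] := ltnP i k.+1.
    have -> : wpos k.+1 (size u).+1 i = (i.-1).+1 by rewrite /wpos ik; lia.
    have -> : wpos k (size u).+1 i.-1 = i.-1 by rewrite /wpos ifT //; lia.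
    by rewrite /= ifT //; lia.
  have -> : wpos k.+1 (size u).+1 i = ((size u).+1 + k - i.+1).+1.
    by rewrite /wpos ifF; lia.
  have -> : wpos k (size u).+1 i = ((size u).+1 + k - i.+1).
    by rewrite /wpos ifF; lia.
  by rewrite /= ifT //; lia.
Qed.

Lemma pinv_wpart k u : k <= size u ->
  pinv (wpart k u) = wpart (size u - k) (rev u).
Proof.
move=> leku; rewrite /pinv /=.
pose g i := if i < size u - k then k + i else i - (size u - k).
rewrite -(@mkpart_wpart k (size u - k) u (rev u) g k) ?size_rev //; try lia.
- by apply: eq_mkpart => i j _ _; rewrite /g; do ![case: ifP => //].
- by move=> i; rewrite /g; do ![case: ifP]; lia.
- move=> i lti; rewrite nth_rev; last by apply: wpos_lt; lia.
  by rewrite /g /wpos; do ![case: ifP]; move=> *; congr nth; lia.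
Qed.

(** * Words in free products and free groups *)

Definition fword := seq (nat * bool).

Definition gstep (a : nat) (t : seq nat) : seq nat :=
  if t is b :: t' then (if a == b then t' else a :: t) else [:: a].

Definition greduced : pred (seq nat) := sorted (fun a b => a != b).

Lemma gredE u : gred u = foldr gstep [::] u. Proof. by []. Qed.

Lemma gred_cat u v : gred (u ++ v) = foldr gstep (gred v) u.
Proof. by rewrite !gredE foldr_cat. Qed.

Lemma gred_cons a u : gred (a :: u) = gstep a (gred u). Proof. by []. Qed.

Lemma gstep_reduced a t : greduced t -> greduced (gstep a t).
Proof.
case: t => //= b t rt; case: (a =P b) => [_ | /eqP ne] /=.
  exact: path_sorted rt.
by rewrite ne.
Qed.

Lemma gred_reduced u : greduced (gred u).
Proof. by elim: u => // a u IH; rewrite gred_cons gstep_reduced. Qed.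

(** Left multiplication by an involution, on normal forms. Without reducedness it fails: on
    [[:: a; a]] two steps leave the empty word. *)
Lemma gstepK a t : greduced t -> gstep a (gstep a t) = t.
Proof.
case: t => [|b t] /=; first by rewrite eqxx.
case: (a =P b) => [<- | _ _] /=; last by rewrite eqxx.
by case: t => //= c t /andP[/negbTE-> _].
Qed.

Lemma gred_del a u v : gred (u ++ a :: a :: v) = gred (u ++ v).
Proof. by rewrite !gred_cat !gred_cons gstepK ?gred_reduced. Qed.

Lemma gred_catr u v v' : gred v = gred v' -> gred (u ++ v) = gred (u ++ v').
Proof. by rewrite !gred_cat => ->. Qed.

Lemma gred_revK u s v : gred (u ++ rev s ++ s ++ v) = gred (u ++ v).
Proof.
elim: s v => // a s IH v; rewrite rev_cons cat_rcons /= catA gred_del -catA.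
exact: IH.
Qed.

Definition fstep (a : nat * bool) (t : fword) : fword :=
  if t is b :: t' then (if (a.1 == b.1) && (a.2 != b.2) then t' else a :: t)
  else [:: a].

Lemma fred_cons a u : fred (a :: u) = fstep a (fred u). Proof. by []. Qed.

Definition fcancel_free : pred fword :=
  sorted (fun a b => ~~ ((a.1 == b.1) && (a.2 != b.2))).

Lemma fred_cancel_free u : fcancel_free (fred u).
Proof.
elim: u => // a u; rewrite fred_cons; case: (fred u) => //= b t rt.
by case: ifP => [_ | /negbT ne] /=; [exact: path_sorted rt | rewrite ne].
Qed.

Lemma cancel_free_fred u : fcancel_free u -> fred u = u.
Proof.
elim: u => // a u IH cfu; rewrite fred_cons IH; last exact: path_sorted cfu.
by case: u cfu {IH} => //= b u /andP[/negbTE-> _].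
Qed.

Lemma freducedE u : freduced u = fcancel_free u.
Proof.
by apply/eqP/idP => [<-|/cancel_free_fred //]; exact: fred_cancel_free.
Qed.

Lemma fred_reduced u : freduced (fred u).
Proof. by rewrite freducedE fred_cancel_free. Qed.

Lemma finv_reduced u : freduced u -> freduced (finv u).
Proof.
rewrite !freducedE /finv /fcancel_free rev_sorted => ru.
rewrite sorted_map; apply: sub_sorted ru => -[a b] [c d] /=.
by rewrite eq_sym; case: b; case: d.
Qed.

(** * Evaluation of words in a group, and the action by involutions *)

Section GroupTheory.
Variable G : group.
Implicit Types (x y : G) (g h : nat -> G).
Local Notation "x * y" := (gmul x y).
Local Notation "x ^-1" := (ginv x).
Local Notation "1" := (gone G).

Lemma gmulI x y z : x * y = x * z -> y = z.
Proof. by move=> e; rewrite -(gmul1 y) -(gmul1 z) -(gmulV x) -!gmulA e. Qed.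

Lemma gmulr1 x : x * 1 = x.
Proof. by apply: (@gmulI (x^-1)); rewrite gmulA gmulV gmul1. Qed.

Lemma gmulrV x : x * x^-1 = 1.
Proof. by apply: (@gmulI (x^-1)); rewrite gmulA gmulV gmul1 gmulr1. Qed.

Lemma ginv_unique x y : x * y = 1 -> y = x^-1.
Proof. by move=> e; apply: (@gmulI x); rewrite e gmulrV. Qed.

Lemma ginvK x : (x^-1)^-1 = x.
Proof. by symmetry; apply: ginv_unique; exact: gmulV. Qed.

Lemma ginvM x y : (x * y)^-1 = y^-1 * x^-1.
Proof.
symmetry; apply: ginv_unique.
by rewrite gmulA -(gmulA x) gmulrV gmulr1 gmulrV.
Qed.

Lemma ginv1 : 1^-1 = 1.
Proof. by symmetry; apply: ginv_unique; rewrite gmul1. Qed.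

Definition gletter (g : nat -> G) (a : nat * bool) : G :=
  if a.2 then (g a.1)^-1 else g a.1.

Lemma geval_cons g a w : geval g (a :: w) = gletter g a * geval g w.
Proof. by []. Qed.

Lemma geval_cat g u v : geval g (u ++ v) = geval g u * geval g v.
Proof. by elim: u => /= [|a u ->]; rewrite ?gmul1 ?gmulA. Qed.

Lemma geval_inv g u : geval g (finv u) = (geval g u)^-1.
Proof.
elim: u => [|[k b] u IH]; first by rewrite ginv1.
rewrite /finv /= rev_cons -cats1 geval_cat IH ginvM; congr gmul.
by case: b; rewrite /= gmulr1 // ginvK.
Qed.

Lemma geval_red g u : geval g (fred u) = geval g u.
Proof.
elim: u => // a u; rewrite fred_cons geval_cons => <-.
case: (fred u) => //= b t; case: ifP => // /andP[/eqP e1 ne].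
rewrite gmulA /gletter e1; move: ne.
by case: a.2; case: b.2 => // _; rewrite ?gmulV ?gmulrV gmul1.
Qed.

Lemma geval_mul g u v : geval g (fmul u v) = geval g u * geval g v.
Proof. by rewrite geval_red geval_cat. Qed.

Definition wsubst (sigma : nat -> fword) (w : fword) : fword :=
  flatten [seq if a.2 then finv (sigma a.1) else sigma a.1 | a <- w].

Lemma geval_wsubst g sigma w :
  geval g (wsubst sigma w) = geval (fun k => geval g (sigma k)) w.
Proof.
elim: w => // -[k b] w IH; rewrite /wsubst /= geval_cat -/(wsubst sigma w) IH.
by case: b; rewrite //= geval_inv.
Qed.

Lemma eq_geval g h w : g =1 h -> geval g w = geval h w.
Proof. by move=> e; elim: w => //= a w ->; rewrite e. Qed.

(* The involutions (x, b) |-> (x y_i^{+1 or -1}, ~~ b), with exponent [1] iff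
   [b], let the free product of copies of Z_2 act on [G * bool]; on even words
   starting at [false] this reads off y_{i1}^-1 y_{i2} y_{i3}^-1 ... *)
Definition act (y : nat -> G) (s : G * bool) (i : nat) : G * bool :=
  (s.1 * (if s.2 then y i else (y i)^-1), ~~ s.2).

Lemma actK (y : nat -> G) s i : act y (act y s i) i = s.
Proof.
case: s => x [] /=; rewrite /act /=; congr pair.
  by rewrite -gmulA gmulrV gmulr1.
by rewrite -gmulA gmulV gmulr1.
Qed.

Lemma act_parity (y : nat -> G) s u : 
  (foldl (act y) s u).2 = odd (size u) (+) s.2.
Proof.
by elim: u s => //= a u IH s; rewrite IH /=; case: (odd _); case: s.2.
Qed.

Lemma act_gred (y : nat -> G) s u :
  foldl (act y) s (gred u) = foldl (act y) s u.
Proof.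
elim: u s => // a u IH s; rewrite gred_cons /= -IH.
case: (gred u) => //= b t; case: eqP => //= <-; by rewrite actK.
Qed.

Lemma act_rev (y : nat -> G) s u :
  foldl (act y) (foldl (act y) s u) (rev u) = s.
Proof. by elim: u s => // a u IH s; rewrite rev_cons foldl_rcons IH actK. Qed.

End GroupTheory.

(** [phi] before reduction. Since the letters are involutions, inversion becomes reversal of the
    word. *)
Definition invword (w : fword) : seq nat :=
  flatten [seq if a.2 then [:: a.1.+1; 0] else [:: 0; a.1.+1] | a <- w].

Lemma phiE w : phi w = gred (invword w). Proof. by []. Qed.

Lemma invword_cat u v : invword (u ++ v) = invword u ++ invword v.
Proof. by rewrite /invword map_cat flatten_cat. Qed.

Lemma invword_cons k b w :
  invword ((k, b) :: w) =
  (if b then [:: k.+1; 0] else [:: 0; k.+1]) ++ invword w.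
Proof. by []. Qed.

Lemma invword_inv u : invword (finv u) = rev (invword u).
Proof.
elim: u => // -[k b] u IH; rewrite /finv /= rev_cons -cats1 invword_cat IH.
by rewrite invword_cons rev_cat; case: b.
Qed.

(** Cancelling a letter against its inverse amounts to two nested cancellations of involutions. *)
Lemma phi_fred w : phi (fred w) = phi w.
Proof.
rewrite !phiE; elim: w => // -[k b] w IH; rewrite fred_cons invword_cons.
rewrite -(gred_catr _ IH); case: (fred w) => // -[j c] t /=.
case: ifP => // /andP[/eqP <-]; rewrite invword_cons.
case: b; case: c => // _; apply: esym.
  exact: etrans (gred_del 0 [:: k.+1] _) (gred_del k.+1 [::] _).
exact: etrans (gred_del k.+1 [:: 0] _) (gred_del 0 [::] _).
Qed.

Definition gpos (i : nat) : fword :=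
  if i is k.+1 then [:: (k, false)] else [::].

(* a_i a_j = x_{i-1}^-1 x_{j-1}, where x_{-1} = 1; odd words get a junk value. *)
Fixpoint evenword (u : seq nat) : fword :=
  if u is i :: j :: u' then finv (gpos i) ++ gpos j ++ evenword u' else [::].

Lemma seq_ind2 (T : Type) (P : seq T -> Prop) :
  P [::] -> (forall i j u, P u -> P (i :: j :: u)) ->
  forall u, ~~ odd (size u) -> P u.
Proof.
move=> P0 P2 u; have [n] := ubnP (size u); elim: n u => // n IH [|i [|j u]] //=.
by rewrite !ltnS negbK => lt ev; apply/P2/IH => //; lia.
Qed.

Lemma phi_evenword u : ~~ odd (size u) -> phi (evenword u) = gred u.
Proof.
move: u; apply: seq_ind2 => // i j u; rewrite !phiE => IH /=.
rewrite !invword_cat invword_inv.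
have e1 k v : gred (rev (invword (gpos k)) ++ v) = gred (k :: 0 :: v).
  by case: k => //=; apply/esym/(gred_del 0 [::]).
have e2 k v : gred (invword (gpos k) ++ v) = gred (0 :: k :: v).
  by case: k => //=; apply/esym/(gred_del 0 [::]).
rewrite e1 (gred_catr [:: i; 0] (e2 _ _)) 
  (gred_del 0 [:: i] (j :: _)).
exact: (gred_catr [:: i; j] IH).
Qed.

(** The normalised family with y_0 = 1, for which y_0^-1 y_{k+1} is the value given to x_k. *)
Definition gshift (G : group) (g : nat -> G) (i : nat) : G :=
  if i is k.+1 then g k else gone G.

Lemma act_evenword (G : group) (g : nat -> G) x u : ~~ odd (size u) ->
  foldl (act (gshift g)) (x, false) u = (gmul x (geval g (evenword u)), false).
Proof.
move=> ev; move: u ev x; apply: (@seq_ind2 nat) => [x|i j u IH x] /=.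
  by rewrite gmulr1.
rewrite IH; congr pair.
rewrite !geval_cat geval_inv !gmulA; congr (gmul (gmul (gmul _ _) _) _).
  by case: i => //= k; rewrite gmulr1.
by case: j => //= k; rewrite gmulr1.
Qed.

(** For either starting flag the word acts by a value of [w] in [G], so an identity acts trivially
    for every family [y], normalised or not. *)
Lemma act_invword (G : group) (y : nat -> G) x b w :
  foldl (act y) (x, b) (invword w) =
  (gmul x (geval (fun k => if b then gmul (y 0) (ginv (y k.+1))
                           else gmul (ginv (y 0)) (y k.+1)) w), b).
Proof.
elim: w x => [|[k c] w IH] x; first by rewrite /= gmulr1.
rewrite invword_cons geval_cons foldl_cat /gletter /=.
by case: c; case: b IH => IH /=; rewrite IH !gmulA ?ginvM ?ginvK ?gmulA.
Qed.

(** The value of a word can be read off the action of its image under [phi] for the normalised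
    family; this plays the part of injectivity of [phi]. *)
Lemma phi_geval w w' (G : group) (g : nat -> G) :
  phi w = phi w' -> geval g w = geval g w'.
Proof.
move=> e; have h v :
    geval g v = (foldl (act (gshift g)) (gone G, false) (phi v)).1.
  rewrite phiE act_gred act_invword /= gmul1; apply: eq_geval => k.
  by rewrite ginv1 gmul1.
by rewrite !h e.
Qed.

Lemma IdV_phi V w w' : freduced w -> IdV V w' -> phi w = phi w' -> IdV V w.
Proof.
by move=> rw [_ h] e; split=> // G VG g; rewrite (phi_geval g e); apply: h.
Qed.

Lemma IdV_fred V w : (forall G, V G -> identical w G) -> IdV V (fred w).
Proof.
by move=> h; split=> [|G VG g]; [exact: fred_reduced | rewrite geval_red h].
Qed.

Lemma IdV_wsubst V sigma w : (forall G, V G -> identical w G) ->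
  IdV V (fred (wsubst sigma w)).
Proof. by move=> h; apply: IdV_fred => G VG g; rewrite geval_wsubst h. Qed.

Lemma IdV_proper V : nontrivialV V -> fproper (IdV V).
Proof.
case=> G [VG [x nx]]; exists (gen 0); split=> // -[_ /(_ G VG (fun=> x))] /=.
by rewrite gmulr1.
Qed.

(** Identities are stable under every substitution, which settles the four families of endomorphisms
    at once; conjugates are evaluated directly. *)
Lemma IdV_S_invariant V : S_invariant (IdV V).
Proof.
have sub sigma w : IdV V w -> IdV V (fsubst sigma w).
  by case=> _; apply: IdV_wsubst.
split; first split.
- by move=> w [].
- by split.
- move=> u v [_ hu] [_ hv]; apply: IdV_fred => G VG g.
  by rewrite geval_cat hu // hv // gmul1.
- move=> u [ru hu]; split; first exact: finv_reduced.
  by move=> G VG g; rewrite geval_inv hu // ginv1.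
do 4![split; first by move=> *; exact: sub].
move=> u w ru [_ hw]; apply: IdV_fred => G VG g.
by rewrite geval_cat geval_mul hw // gmulr1 geval_inv gmulrV.
Qed.

(** * The category of a variety *)

Lemma map_wpos k u : k <= size u ->
  map (fun i => nth 0 u (wpos k (size u) i)) (row_order k (size u - k)) = u.
Proof.
move=> leku; have e : k + (size u - k) = size u by lia.
apply: (@eq_from_nth _ 0); rewrite size_map size_row_order e // => i lti.
rewrite (nth_map 0) ?size_row_order ?e // nth_row_order ?e //.
by rewrite wposK //; lia.
Qed.

(** * Connected components of the diagram glued from two partitions *)

Section Composition.
Variables (p q : part).
Hypothesis plq : pl p = pk q.
Local Notation k := (pk p).
Local Notation l := (pl p).
Local Notation m := (pl q).
Local Notation N := (pk p + pl p + pl q).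

Definition comp_edge : rel 'I_N.+1 := [rel x y : 'I_N.+1 |
      ((x < k + l) && (y < k + l) && (lab p x == lab p y))
      || [&& k <= x, k <= y, x < N, y < N & lab q (x - k) == lab q (y - k)]].

Definition comp_conn (x y : nat) : bool :=
  connect comp_edge (inord x) (inord y).

Definition comp_label (x : nat) : nat := find (comp_conn x) (iota 0 N.+1).

Definition comp_outer (i : nat) : nat := if i < k then i else i + l.

Lemma pcompE : pcomp p q = mkpart k m (fun i => comp_label (comp_outer i)).
Proof. by []. Qed.

Lemma comp_edge_sym : symmetric comp_edge.
Proof.
move=> x y; rewrite /comp_edge /= (eq_sym (lab p x)) (eq_sym (lab q _)).
congr (_ || _); first by congr (_ && _); rewrite andbC.
by case: (k <= x); case: (k <= y); case: (x < N); case: (y < N).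
Qed.

Lemma comp_conn_sym x y : comp_conn x y = comp_conn y x.
Proof. exact: (sym_connect_sym comp_edge_sym). Qed.

Lemma comp_conn_trans y x z : comp_conn x y -> comp_conn y z -> comp_conn x z.
Proof. exact: connect_trans. Qed.

Lemma comp_conn_top x y : x < k + l -> y < k + l -> lab p x = lab p y ->
  comp_conn x y.
Proof.
by move=> ltx lty e; apply: connect1; rewrite /comp_edge /= !inordK; lia.
Qed.

Lemma comp_conn_bot x y : k <= x < N -> k <= y < N ->
  lab q (x - k) = lab q (y - k) -> comp_conn x y.
Proof.
by move=> ltx lty e; apply: connect1; rewrite /comp_edge /= !inordK; lia.
Qed.

Lemma comp_label_eq x y : x < N.+1 -> y < N.+1 ->
  (comp_label x == comp_label y) = comp_conn x y.
Proof.
have hasx z : z < N.+1 -> has (comp_conn z) (iota 0 N.+1).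
  by move=> ltz; apply/hasP; exists z; [rewrite mem_iota | exact: connect0].
have P z : z < N.+1 -> comp_conn z (comp_label z).
  move=> /hasx hz; have := nth_find 0 hz; rewrite nth_iota //.
  by rewrite -[X in _ < X](size_iota 0) -has_find.
move=> ltx lty; apply/eqP/idP => [e | cxy].
  by apply: (comp_conn_trans (P x ltx)); rewrite e comp_conn_sym P.
apply: eq_find => z; apply/idP/idP; last exact: comp_conn_trans.
by apply: comp_conn_trans; rewrite comp_conn_sym.
Qed.

(** A function constant along the edges is constant along paths, hence on components. *)
Lemma comp_conn_inv (h : nat -> nat) :
  (forall x y, x < k + l -> y < k + l -> lab p x = lab p y -> h x = h y) ->
  (forall x y, k <= x < N -> k <= y < N -> lab q (x - k) = lab q (y - k) ->
     h x = h y) ->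
  forall x y, x < N.+1 -> y < N.+1 -> comp_conn x y -> h x = h y.
Proof.
move=> h1 h2 x y ltx lty /connectP[s].
have -> : h x = h (inord x : 'I_N.+1) by rewrite inordK.
have -> : h y = h (inord y : 'I_N.+1) by rewrite inordK.
elim: s (inord x) => [|z s IH] a /=; first by move=> _ ->.
case/andP=> e /IH{}IH /IH <-; move: e; rewrite /comp_edge /=.
case/orP; first by case/andP=> /andP[? ?] /eqP; apply: h1.
by case/and5P=> ? ? ? ? /eqP; apply: h2; apply/andP.
Qed.

End Composition.

(** * Categories of partitions defined by a closed set of words *)

Section WordCategory.
Variable T : seq nat -> Prop.
Hypothesis Tmap : forall f u, T u -> T (map f u).
Hypothesis Tpair : forall a, T [:: a; a].
Hypothesis Tins : forall u v w, T (u ++ w) -> T v -> T (u ++ v ++ w).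
Hypothesis Trev : forall u, T u -> T (rev u).
Hypothesis Tcyc : forall a u, T (a :: u) <-> T (rcons u a).
Hypothesis Tcomp : forall u v w, T (u ++ rev v) -> T (v ++ w) -> T (u ++ w).

(** The hypotheses on [T] are the category axioms in terms of words: [Tins] serves tensor products,
    [Trev] the involution, [Tcyc] left rotations and [Tcomp] composition. [Tmap] allows blocks to be
    merged. *)
Definition word_cat (p : part) : Prop := wf_part p /\ T (pword p id).

Lemma T_relabel (f g : nat -> nat) s :
  {in s &, forall x y, f x = f y -> g x = g y} -> T (map f s) -> T (map g s).
Proof.
(* [g] factors through [f] on [s]: [h] applies [g] to the first letter of [s] whose image under [f]
   is [v]. *)
move=> efg Tf; pose h v := g (nth 0 s (find (fun x => f x == v) s)).
suff -> : map g s = map h (map f s) by apply: Tmap.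
rewrite -map_comp; apply/eq_in_map => x xs /=.
have hx : has (fun z => f z == f x) s by apply/hasP; exists x.
apply: efg => //; first by rewrite mem_nth // -has_find.
by apply/esym/eqP/(nth_find 0 hx).
Qed.

Lemma word_cat_mkpart k l f :
  T (map f (row_order k l)) -> word_cat (mkpart k l f).
Proof.
move=> Tf; split; first exact: mkpart_wf.
apply: T_relabel Tf => x y; rewrite !mem_row_order => ltx lty exy.
by apply/eqP; rewrite lab_mkpart_eq // exy.
Qed.

Lemma word_cat_wpart k u : k <= size u -> T u -> word_cat (wpart k u).
Proof. by move=> leku Tu; apply: word_cat_mkpart; rewrite map_wpos. Qed.

(** The word of [q] is inserted between the upper and the lower part of the word of [p]; even and
    odd labels keep the blocks apart. *)
Lemma word_cat_tensor p q : word_cat p -> word_cat q -> word_cat (ptensor p q).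
Proof.
case=> _ Tp [_ Tq]; apply: word_cat_mkpart; set f := (X in map X _).
have -> : map f (row_order (pk p + pk q) (pl p + pl q)) =
  map (fun i => (lab p i).*2) (iota 0 (pk p)) ++
  map (fun i => (lab q i).*2.+1) (row_order (pk q) (pl q)) ++
  map (fun i => (lab p i).*2) (rev (iota (pk p) (pl p))).
  rewrite /row_order !iotaD rev_cat !map_cat -!catA !map_rev add0n.
  rewrite -[in iota (pk p) (pk q)](addn0 (pk p)).
  rewrite -[in iota (pk p + pk q) (pl p)](addnC (pk q)).
  rewrite -[in iota (pk p + pk q + pl p) (pl q)](addnAC (pk p)).
  rewrite -[in iota (pk p + pl p + pk q) (pl q)]addnC.
  rewrite (addnC (pk q)) !iotaDl -!map_comp.
  congr (_ ++ (_ ++ (rev _ ++ rev _))); apply/eq_in_map => i;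
    rewrite mem_iota /f /= => lti.
  - by rewrite ifT //; lia.
  - rewrite ifF; last by lia.
    by rewrite ifT; [congr (lab q _).*2.+1|]; lia.
  - rewrite ifF; last by lia.
    rewrite ifF; last by lia.
    rewrite ifF; last by lia.
    by congr (lab q _).*2.+1; lia.
  - rewrite ifF; last by lia.
    rewrite ifF; last by lia.
    by rewrite ifT; [congr (lab p _).*2|]; lia.
apply: Tins.
  have := Tmap double Tp; rewrite pword_id -map_comp /row_order map_cat.
  by [].
by have := Tmap (fun i => i.*2.+1) Tq; rewrite pword_id -map_comp.
Qed.

(** Relabelled by components, the middle row is read backwards at the end of the word of [p] and
    forwards at the start of that of [q], so [Tcomp] cancels it. *)
Lemma word_cat_comp p q : word_cat p -> word_cat q -> pl p = pk q ->
  word_cat (pcomp p q).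
Proof.
case=> _ Tp [_ Tq] e; rewrite pcompE; apply: word_cat_mkpart.
rewrite /row_order map_cat.
pose h := comp_label p q.
have hp : T (map h (row_order (pk p) (pl p))).
  apply: T_relabel Tp => x y; rewrite !mem_row_order => ltx lty exy.
  by apply/eqP; rewrite comp_label_eq ?comp_conn_top //; lia.
have hq : T (map (fun i => h (pk p + i)) (row_order (pk q) (pl q))).
  apply: T_relabel Tq => x y; rewrite !mem_row_order => ltx lty exy.
  apply/eqP; rewrite comp_label_eq ?comp_conn_bot //; try lia.
  by rewrite !addKn.
rewrite /row_order map_cat map_rev in hp; rewrite /row_order map_cat in hq.
have -> : map (fun i => h (comp_outer p i)) (iota 0 (pk p)) =
          map h (iota 0 (pk p)).
  by apply/eq_in_map => i; rewrite mem_iota /comp_outer => lti; rewrite ifT.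
apply: (Tcomp hp).
have -> : map h (iota (pk p) (pl p)) =
          map (fun i => h (pk p + i)) (iota 0 (pk q)).
  by rewrite -[X in iota X _]addn0 iotaDl -map_comp e.
have -> // : map (fun i => h (comp_outer p i)) (rev (iota (pk p) (pl q))) =
   map (fun i => h (pk p + i)) (rev (iota (pk q) (pl q))).
rewrite !map_rev -[X in iota X _]addn0.
rewrite -[X in _ = rev (map _ (iota X _))]addn0 !iotaDl -!map_comp.
congr rev; apply: eq_map => i /=; rewrite /comp_outer ifF; last by lia.
by congr h; lia.
Qed.

Lemma word_cat_category : category word_cat.
Proof.
have wfE p : word_cat p -> wpart (pk p) (pword p id) = p.
  by case=> wfp _; apply: wpart_pword.
split; first by move=> p [].
split; first by split => //; exact: (Tpair 0).
split; first by split => //; exact: (Tpair 0).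
split; first exact: word_cat_tensor.
split; first exact: word_cat_comp.
split=> p Cp; have [_ Tp] := Cp; have su := size_pword p id.
  rewrite -(wfE p Cp) pinv_wpart; last by lia.
  by apply: word_cat_wpart; [rewrite size_rev; lia | exact: Trev].
split=> lt0; rewrite -(wfE p Cp); split.
- case: (pk p) lt0 su => // k _; case: (pword p id) Tp => // a u Tp /= su.
  rewrite rotUL_wpart; last by lia.
  by apply: word_cat_wpart; rewrite ?size_rcons; [lia | exact/Tcyc].
- case: (pk p) lt0 su => // k _ su; rewrite rotUR_wpart; last by lia.
  by apply: word_cat_wpart => //; lia.
- case/lastP: (pword p id) Tp su => [|u a Tp] su; first by move: su => /=; lia.
  rewrite size_rcons in su; rewrite rotLU_wpart; last by lia.
  by apply: word_cat_wpart => /=; [lia | exact/Tcyc].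
- rewrite rotLR_wpart; last by lia.
  by apply: word_cat_wpart => //; lia.
Qed.

End WordCategory.

Section VarietyCategory.
Variable V : group -> Prop.

Definition trivial_word (u : seq nat) : Prop :=
  forall G, V G -> forall (y : nat -> G) s, foldl (act y) s u = s.

Lemma foldl_act_map (G : group) (y : nat -> G) f s u :
  foldl (act y) s (map f u) = foldl (act (fun i => y (f i))) s u.
Proof. by elim: u s => //= a u IH s; rewrite IH. Qed.

Lemma trivial_word_even u : nontrivialV V -> trivial_word u -> ~~ odd (size u).
Proof.
case=> G [VG [x _]] /(_ G VG (fun=> x) (x, false))/(congr1 snd).
by rewrite act_parity /= addbF => ->.
Qed.

Lemma trivial_word_category : category (word_cat trivial_word).
Proof.
apply: word_cat_category.
- by move=> f u Tu G VG y s; rewrite foldl_act_map Tu.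
- by move=> a G VG y s /=; rewrite actK.
- by move=> u v w Tuw Tv G VG y s; rewrite !foldl_cat Tv // -foldl_cat Tuw.
- by move=> u Tu G VG y s; rewrite -[in LHS](Tu G VG y s) act_rev.
(* A cyclic shift is conjugation by the involution of [a]. *)
- move=> a u; split=> Tu G VG y s.
    by rewrite -[s in LHS](actK y s a) foldl_rcons
      -/(foldl _ _ (a :: u)) [foldl _ _ _](Tu G VG y) actK.
  have := Tu G VG y (act y s a); rewrite foldl_rcons.
  by move=> /(congr1 (act y ^~ a)); rewrite !actK.
- move=> u v w Tuv Tvw G VG y s; rewrite foldl_cat.
  have := Tuv G VG y s; rewrite foldl_cat => {2}<-.
  set s' := foldl _ s u.
  (* Acting by [rev v] and then [v] changes nothing; this puts [v] in front of [w], where the second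
     hypothesis applies. *)
  rewrite -[s' in LHS](act_rev y s' (rev v)) revK -foldl_cat.
  by rewrite Tvw.
Qed.

Lemma trivial_invword w : (forall G, V G -> identical w G) ->
  trivial_word (invword w).
Proof.
by move=> hw G VG y [x b]; rewrite act_invword (hw G VG) gmulr1.
Qed.

Lemma trivial_word_evenword u : nontrivialV V -> trivial_word u ->
  IdV V (fred (evenword u)).
Proof.
move=> nV Tu; have ev := trivial_word_even nV Tu.
apply: IdV_fred => G VG g; have := Tu G VG (gshift g) (gone G, false).
by rewrite act_evenword // gmul1 => -[].
Qed.

Lemma trivial_word_is_CV : nontrivialV V -> is_CV V (word_cat trivial_word).
Proof.
move=> nV; split.
  split; first exact: trivial_word_category.
  - by split=> // G VG y s /=; rewrite !actK.
  - by split=> // G VG y s; rewrite /= !actK.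
  - case: nV => G [VG [x nx]] [_ /(_ G VG)].
    (* The family x, 1, 1, ... tells the two letters of the double singleton apart: its word sends 1
       to x. *)
    move=> /(_ (fun i => if i is 0 then x else gone G) (gone G, false)) [].
    by rewrite /= ginv1 !gmul1.
move=> g; split=> [[p [ell [[wfp Tp] inj ->]]] | [w [Iw ->]]].
  have T1 : trivial_word (pword p ell).
    have -> : pword p ell = map ell (pword p id).
      by rewrite pwordE pword_id -map_comp.
    by move=> G VG y s; rewrite foldl_act_map Tp.
  exists (fred (evenword (pword p ell))); split.
    exact: trivial_word_evenword.
  by rewrite phi_fred phi_evenword // trivial_word_even.
have [_ /trivial_invword Tw] := Iw; set u := invword w in Tw.
(* All points are put in the upper row, where [wpos] is the identity; [f] then gives back to each
   block its letter in [u]. *)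
pose f i := nth 0 u (wpos (size u) (size u) i).
have cat_u : word_cat trivial_word (wpart (size u) u).
  apply: word_cat_wpart => //.
  by move=> h v Tv G VG y s; rewrite foldl_act_map Tv.
have lu : size u + (size u - size u) = size u by lia.
have labE i : i < size u -> f (lab (wpart (size u) u) i) = f i.
  by move=> lti; rewrite lab_mkpart lu //; apply: (find_iota_eq f lti).
exists (wpart (size u) u), f; split=> //.
  move=> i j; rewrite [pk _ + pl _]lu => lti ltj; rewrite !labE // => e.
  by apply/eqP; rewrite lab_mkpart_eq ?lu // -/(f i) -/(f j) e.
rewrite phiE -/u; congr gred; rewrite -[LHS](map_wpos (leqnn _)) pwordE.
by apply/eq_in_map => i; rewrite mem_row_order lu => lti; rewrite /= labE.
Qed.

End VarietyCategory.

(** * Categories containing the four block and the pair positioner *)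

(** A certificate for computing compositions: the fibres of [h] on the glued diagram are exactly its
    components. *)
Lemma pcomp_mkpart p q (h : nat -> nat) : pl p = pk q ->
  let N := pk p + pl p + pl q in
  (forall x y, x < pk p + pl p -> y < pk p + pl p -> lab p x = lab p y ->
     h x = h y) ->
  (forall x y, pk p <= x < N -> pk p <= y < N ->
     lab q (x - pk p) = lab q (y - pk p) -> h x = h y) ->
  (forall x y, x < N -> y < N -> h x = h y -> comp_conn p q x y) ->
  pcomp p q = mkpart (pk p) (pl q) (fun i => h (comp_outer p i)).
Proof.
move=> e N h1 h2 h3; rewrite pcompE; apply: eq_mkpart => i j lti ltj.
have o_lt x : x < pk p + pl q -> comp_outer p x < N.
  by rewrite /comp_outer /N; case: ifP; lia.
rewrite comp_label_eq; try exact/ltnW/o_lt.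
apply/idP/eqP; last by apply: h3; apply: o_lt.
by apply: (comp_conn_inv h1 h2); apply/ltnW/o_lt.
Qed.

Section CategoryWords.
Variable D : part -> Prop.
Hypotheses (catD : category D) (Db4 : D b4) (Drho : D rho).

Definition Kword (u : seq nat) : Prop := D (wpart (size u) u).

Lemma cat_wf p : D p -> wf_part p. Proof. by case: catD => h _; apply: h. Qed.

Lemma cat_wpartS k u : k < size u -> D (wpart k u) <-> D (wpart k.+1 u).
Proof.
case: catD => _ [_ [_ [_ [_ [_ rot]]]]] ltku; split=> Dp.
  by have [_ []] := rot _ Dp; rewrite /= ?subn_gt0 // rotLR_wpart.
by have [/(_ isT)[_] + _] := rot _ Dp; rewrite rotUR_wpart.
Qed.

(** Right rotations move the row boundary without changing the word, so all ways of splitting [u]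
    into two rows are equivalent. *)
Lemma cat_wpart k u : k <= size u -> D (wpart k u) <-> Kword u.
Proof.
have h j : j <= size u -> D (wpart 0 u) <-> D (wpart j u).
  by elim: j => // j IH ltj; rewrite (IH (ltnW ltj)) cat_wpartS.
by move=> leku; exact: iff_trans (iff_sym (h k leku)) (h _ (leqnn _)).
Qed.

Lemma cat_Kword p ell : D p -> block_inj p ell -> Kword (pword p ell).
Proof.
move=> Dp inj; apply/(@cat_wpart (pk p)); first by rewrite size_pword leq_addr.
by rewrite wpart_pword ?cat_wf.
Qed.

Lemma Kword_cat p : wf_part p -> Kword (pword p id) -> D p.
Proof.
move=> wfp /(@cat_wpart (pk p)); rewrite wpart_pword //.
by apply; rewrite size_pword leq_addr.
Qed.

Lemma Kword_ker u v : same_ker u v -> Kword u -> Kword v.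
Proof. by move=> ek; rewrite /Kword (wpart_ker _ ek) // (proj1 ek). Qed.

Lemma Kword_cyc a u : Kword (a :: u) -> Kword (rcons u a).
Proof.
case: catD => _ [_ [_ [_ [_ [_ rot]]]]] /rot[/(_ isT)[+ _] _].
by rewrite rotUL_wpart // cat_wpart // size_rcons.
Qed.

Lemma Kword_rot u v : Kword (u ++ v) -> Kword (v ++ u).
Proof.
elim: u v => [|a u IH] v; first by rewrite cats0.
by move=> /Kword_cyc; rewrite rcons_cat => /IH; rewrite cat_rcons.
Qed.

Lemma Kword_rev u : Kword u -> Kword (rev u).
Proof.
case: catD => _ [_ [_ [_ [_ [inv _]]]]] /inv.
by rewrite pinv_wpart // cat_wpart // size_rev leq_subr.
Qed.

Lemma Kword_pair a : Kword [:: a; a].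
Proof.
case: catD => _ [Dp _]; apply: (@cat_Kword pair_part (fun=> a)) => //.
by move=> [|[|i]] [|[|j]].
Qed.

(** With all points in the upper row the tensor product is concatenation; the two arithmetic
    relabellings make the letters disjoint. *)
Lemma Kword_tensor u v : Kword u -> Kword v ->
  Kword (map double u ++ map (fun x => x.*2.+1) v).
Proof.
case: catD => _ [_ [_ [ten _]]] Ku Kv; have := ten _ _ Ku Kv.
set s := _ ++ _.
suff <- : wpart (size s) s =
          ptensor (wpart (size u) u) (wpart (size v) v) by [].
have ss : size s = size u + size v by rewrite /s size_cat !size_map.
rewrite /wpart subnn /ptensor /= !subnn addn0 ss; apply: eq_mkpart => i j.
rewrite addn0 => lti ltj; rewrite /s /wpos lti ltj !nth_cat size_map.
have L w x y : x < size w -> y < size w ->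
    (lab (wpart (size w) w) x == lab (wpart (size w) w) y) =
    (nth 0 w x == nth 0 w y).
  by move=> ltx lty; rewrite lab_wpart_eq // /wpos ltx lty.
have dE (x y : nat) : (x.*2 == y.*2) = (x == y) by lia.
have dSE (x y : nat) : (x.*2.+1 == y.*2.+1) = (x == y) by lia.
have Lu := L u; have Lv := L v; rewrite /wpart !subnn in Lu Lv.
case: (ltnP i (size u)) => hi; case: (ltnP j (size u)) => hj;
  rewrite !(nth_map 0); try lia.
- by rewrite !dE Lu.
- by rewrite !dSE Lv //; lia.
Qed.

(* Composition with [p] on top replaces the upper row [v] by [v']. *)
Lemma Kword_top p v' v t : D p -> size v' = pk p -> size v = pl p ->
  (forall x y, x < pk p + pl p -> y < pk p + pl p -> lab p x = lab p y ->
     nth 0 (v' ++ v) x = nth 0 (v' ++ v) y) ->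
  (forall x, x < pk p ->
     exists2 m, pk p <= m < pk p + pl p & lab p x = lab p m) ->
  Kword (v ++ t) -> Kword (v' ++ t).
Proof.
move=> Dp sv' sv hlab htop Kvt.
have lev : size v <= size (v ++ t) by rewrite size_cat leq_addr.
have szvt : size (v ++ t) = pl p + size t by rewrite size_cat sv.
have szv't : size (v' ++ t) = pk p + size t by rewrite size_cat sv'.
have Dq : D (wpart (size v) (v ++ t)) by apply/cat_wpart.
case: catD => _ [_ [_ [_ [comp _]]]]; have := comp _ _ Dp Dq (esym sv).
pose h x := if x < pk p then nth 0 v' x
            else nth 0 (v ++ t) (wpos (size v) (size (v ++ t)) (x - pk p)).
rewrite (@pcomp_mkpart _ _ h) //=.
- suff -> : mkpart (pk p) (size (v ++ t) - size v) 
               (fun i => h (comp_outer p i)) = wpart (pk p) (v' ++ t).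
    by rewrite cat_wpart // szv't leq_addr.
  rewrite /wpart szv't szvt sv !addKn; apply: eq_mkpart.
  have hE i : i < pk p + size t -> h (comp_outer p i) =
      nth 0 (v' ++ t) (wpos (pk p) (pk p + size t) i).
    move=> lti; rewrite /h /comp_outer /wpos [nth 0 (v' ++ t) _]nth_cat sv'.
    have [ltik|leik] := ltnP i (pk p); first by rewrite ltik.
    rewrite ifF; last by lia.
    rewrite ifF; last by lia.
    rewrite ifF; last by lia.
    rewrite nth_cat ifF; last by rewrite szvt sv; lia.
    by congr nth; rewrite szvt sv; lia.
  by move=> i j lti ltj; rewrite !hE.
- have hv x : x < pk p + pl p -> h x = nth 0 (v' ++ v) x.
    move=> ltx; rewrite /h [RHS]nth_cat sv'; case: ifP => // gex.
    rewrite /wpos ifT; last by lia.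
    by rewrite nth_cat ifT //; lia.
  by move=> x y ltx lty exy; rewrite !hv //; apply: hlab.
- move=> x y ltx lty /eqP; rewrite lab_wpart_eq //; try by lia.
  rewrite /h => /eqP exy; rewrite ifF; last by lia.
  by rewrite ifF //; lia.
(* By [htop] every upper vertex shares a block of [p] with a middle vertex, so only vertices of the
   second partition need to be compared. *)
- have low x : x < pk p + pl p + (size (v ++ t) - size v) ->
     exists m, [/\ pk p <= m < pk p + pl p + (size (v ++ t) - size v), h x = h m
       & comp_conn p (wpart (size v) (v ++ t)) x m].
    move=> ltx; have [ltxk|lekx] := ltnP x (pk p); last first.
      by exists x; split=> //; [lia|exact: connect0].
    have [m ltm em] := htop x ltxk; exists m; split=> //; first by lia.
      rewrite /h ltxk ifF; last by lia.
      have -> : nth 0 v' x = nth 0 v (m - pk p).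
        have : nth 0 (v' ++ v) x = nth 0 (v' ++ v) m by apply: hlab => //; lia.
        by rewrite !nth_cat sv' ltxk ifF //; lia.
      rewrite /wpos ifT; last by lia.
      by rewrite nth_cat ifT //; lia.
    by apply: comp_conn_top => //; lia.
  move=> x y /low[m [ltm -> cxm]] /low[n [ltn -> cyn]] emn.
  apply: (comp_conn_trans cxm); rewrite comp_conn_sym.
  apply: (comp_conn_trans cyn); rewrite comp_conn_sym.
  apply: comp_conn_bot => //=.
  apply/eqP; rewrite lab_wpart_eq //; try by lia.
  move: emn; rewrite /h ifF; last by lia.
  by rewrite ifF; [move=> -> | lia].
Qed.

(** The four block, rotated into P(3,1), is composed on top of the first point. *)
Lemma Kword_triple a t : Kword (a :: t) -> Kword [:: a, a, a & t].
Proof.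
apply: (@Kword_top (wpart 3 [:: 0; 0; 0; 0]) [:: a; a; a] [:: a]) => //.
- by rewrite cat_wpart // -(@cat_wpart 0).
- by move=> [|[|[|[|x]]]] [|[|[|[|y]]]].
- by move=> [|[|[|x]]] // _; exists 3.
Qed.

Lemma Kword_rho a b t : Kword [:: b, a, a & t] -> Kword [:: a, a, b & t].
Proof.
apply: (@Kword_top rho [:: a; a; b] [:: b; a; a]) => //.
- by move=> [|[|[|[|[|[|x]]]]]] [|[|[|[|[|[|y]]]]]].
- by move=> [|[|[|x]]] // _; [exists 4 | exists 4 | exists 3].
Qed.

Definition letter_subst (a b x : nat) : nat := if x == a then b else x.

(** Composing with the pair partition joins the blocks of the first two points and removes these
    points. *)
Lemma Kword_cap a b t : Kword [:: a, b & t] -> Kword (map (letter_subst a b) t).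
Proof.
move=> K; have Dq : D (wpart 2 [:: a, b & t]) by apply/cat_wpart.
case: catD => _ [Dp [_ [_ [comp _]]]]; have := comp _ _ Dp Dq erefl.
set u := [:: a, b & t]; have su : size u = (size t).+2 by [].
pose h x := letter_subst a b (nth 0 u (wpos 2 (size u) x)).
have h0 : h 0 = b by rewrite /h /letter_subst /= eqxx.
have h1 : h 1 = b by rewrite /h /letter_subst /=; case: eqP.
have lq x y : x < size u -> y < size u ->
    (lab (wpart 2 u) x == lab (wpart 2 u) y) =
    (nth 0 u (wpos 2 (size u) x) == nth 0 u (wpos 2 (size u) y)).
  by apply: lab_wpart_eq.
rewrite (@pcomp_mkpart _ _ h) //=; rewrite ?add0n ?subSS ?subn0.
- suff -> : mkpart 0 (size t) (fun i => h (comp_outer pair_part i)) =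
            wpart 0 (map (letter_subst a b) t).
    by rewrite cat_wpart.
  rewrite /wpart size_map subn0; apply: eq_mkpart.
  have hE i : i < size t -> h (comp_outer pair_part i) =
      nth 0 (map (letter_subst a b) t) (wpos 0 (size t) i).
    move=> lti; rewrite /comp_outer /= /h /wpos /= ifF; last by lia.
    rewrite (nth_map 0); last by lia.
    have -> : (size t).+2 + 2 - (i + 2).+1 = (size t + 0 - i.+1).+2 by lia.
    by [].
  by move=> i j lti ltj; rewrite !hE.
- by move=> [|[|x]] [|[|y]] // _ _ _; rewrite ?h0 ?h1.
- move=> x y ltx lty; rewrite !subn0 => /eqP; rewrite lq ?su //; try lia.
  by rewrite -su /h => /eqP->.
- move=> x y ltx lty; have q_conn z w : z < size u -> w < size u ->
      nth 0 u (wpos 2 (size u) z) = nth 0 u (wpos 2 (size u) w) ->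
      comp_conn pair_part (wpart 2 u) z w.
    move=> ltz ltw e; apply: comp_conn_bot => /=; rewrite ?subn0; try lia.
    by apply/eqP; rewrite lq // e.
  have c01 : comp_conn pair_part (wpart 2 u) 0 1 by apply: comp_conn_top.
  have {}ltx : x < size u by lia.
  have {}lty : y < size u by lia.
  (* A vertex either lies in the merged component, represented by vertex 1 with letter [b], or keeps
     its own letter, different from [b]. *)
  have conn z : z < size u ->
      (h z = b /\ comp_conn pair_part (wpart 2 u) z 1) \/
      (h z <> b /\ h z = nth 0 u (wpos 2 (size u) z)).
    move=> ltz; rewrite /h /letter_subst; case: eqP => [ea | na].
      by left; split=> //; apply: comp_conn_trans c01; apply: q_conn.
    have [eb|nb] := eqVneq (nth 0 u (wpos 2 (size u) z)) b.
      by left; split=> //; apply: q_conn.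
    by right; split=> //; apply/eqP.
  case: (conn x ltx) => -[ex cx]; case: (conn y lty) => -[ey cy] exy.
  + by apply: (comp_conn_trans cx); rewrite comp_conn_sym.
  + by case: ey; rewrite -exy.
  + by case: ex; rewrite exy.
  + by apply: q_conn => //; rewrite -cx -cy.
Qed.

Lemma Kword_del u a v : Kword (u ++ [:: a, a & v]) -> Kword (u ++ v).
Proof.
move=> /Kword_rot /Kword_cap.
rewrite (_ : map _ _ = v ++ u); first exact: Kword_rot.
by rewrite -[RHS]map_id; apply: eq_map => x; rewrite /letter_subst; case: eqP.
Qed.

(** The last letter is rotated to the front and the pair is moved past it by [Kword_rho]; induction
    on [t] repeats this. *)
Lemma Kword_move a s t : Kword [:: a, a & s ++ t] -> Kword [:: a, a & t ++ s].
Proof.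
elim/last_ind: t s => [|t b IH] s; first by rewrite cats0.
rewrite -rcons_cat cat_rcons => K; apply: (IH (b :: s)).
apply: Kword_rho; have := @Kword_rot [:: a, a & s ++ t] [:: b].
by rewrite cats1; apply.
Qed.

(** If [a] occurs, one occurrence is tripled and two of the copies slide to the required place.
    Otherwise the pair is a new block, supplied by a tensor product. *)
Lemma Kword_ins u a v : Kword (u ++ v) -> Kword (u ++ [:: a, a & v]).
Proof.
move=> /Kword_rot K; suff /Kword_rot : Kword ([:: a, a & v] ++ u) by [].
rewrite !cat_cons; move: (v ++ u) K => w K {u v}.
have [/splitPr aw|naw] := boolP (a \in w).
  case: aw K => x y /Kword_rot /Kword_triple /Kword_cyc /=.
  rewrite rcons_cat -cats1 => /Kword_move.
  by rewrite -catA.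
have /Kword_rot : Kword (w ++ [:: a; a]); last by [].
(* [f] is injective and reproduces the labels of [Kword_tensor] for [w] and the pair [0 0], whose
   letter becomes 1. *)
pose f x := if x == a then 1 else x.*2.
have : Kword (map f (w ++ [:: a; a])).
  have := Kword_tensor K (Kword_pair 0); rewrite map_cat /= /f eqxx.
  congr (Kword (_ ++ _)); apply/eq_in_map => x xw.
  by rewrite ifN //; apply: contraNneq naw => <-.
apply: Kword_ker; rewrite -[X in same_ker _ X]map_id.
by apply: same_ker_map => x y _ _; rewrite /f; do ![case: eqP]; lia.
Qed.

Lemma Kword_gred u v : Kword (u ++ v) <-> Kword (u ++ gred v).
Proof.
elim: v u => // a v IH u; rewrite gred_cons -cat_rcons {}IH cat_rcons.
case: (gred v) => //= b t; case: eqP => // <-.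
by split=> [/Kword_del | /Kword_ins].
Qed.

Lemma Kword_eq u v : gred u = gred v -> Kword u -> Kword v.
Proof. by move=> e; rewrite (Kword_gred [::] u) (Kword_gred [::] v) /= e. Qed.

(* Insert [a b b a] in front and join the first two points. *)
Lemma Kword_subst a b u : Kword u -> Kword (map (letter_subst a b) u).
Proof.
move=> /(@Kword_ins [::] a) /(@Kword_ins [:: a] b) /Kword_cap /=.
rewrite /letter_subst eqxx -/(letter_subst a b).
by case: eqP => _ /(@Kword_del [::]).
Qed.

Lemma Kword_map f u : Kword u -> Kword (map f u).
Proof.
pose M := (foldr maxn 0 u).+1; pose N := (foldr maxn 0 (map f u)).+1.
have le_max s x : x \in s -> x < (foldr maxn 0 s).+1.
  by elim: s => //= y s IH; rewrite inE => /predU1P[->|/IH]; lia.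
(* Letters below [j] already carry their image; the others wait at [N + x], above all images, so the
   next substitution changes only the letter [j]. *)
pose g j x := if x < j then f x else N + x.
move=> K; have Kg j : Kword (map (g j) u).
  elim: j => [|j IH].
    apply: Kword_ker K; rewrite -[X in same_ker X]map_id.
    by apply: same_ker_map => x y _ _; rewrite /g /= eqn_add2l.
  rewrite (_ : map _ _ = map (letter_subst (N + j) (f j)) (map (g j) u)).
    exact: Kword_subst.
  rewrite -map_comp; apply/eq_in_map => x xu /=; rewrite /g /letter_subst.
  have ltf : f x < N by apply/le_max/map_f.
  have [ltxj|lejx] := ltnP x j.
    by rewrite ifT ?ifF //; lia.
  rewrite eqn_add2l ltnS; have [->|ne] := eqVneq x j; first by rewrite leqnn.
  by rewrite ifF //; lia.
suff -> : map f u = map (g M) u by [].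
by apply/eq_in_map => x /le_max ltx; rewrite /g ltx.
Qed.

(** Halving the labels of the tensor product lets blocks of [u] and [v] with the same letter
    merge. *)
Lemma Kword_mul u v : Kword u -> Kword v -> Kword (u ++ v).
Proof.
move=> Ku Kv; have := Kword_map half (Kword_tensor Ku Kv).
rewrite map_cat -!map_comp (eq_map doubleK) map_id.
by rewrite (@eq_map _ _ _ id) ?map_id // => x /=; rewrite uphalf_double.
Qed.

Lemma Kword_nil : Kword [::].
Proof. exact: (@Kword_del [::] 0 [::] (Kword_pair 0)). Qed.

Lemma Kword_conj s u : Kword u -> Kword (rev s ++ u ++ s).
Proof.
move=> K; rewrite catA; apply: Kword_rot; rewrite catA; apply: Kword_eq K.
by have := gred_revK [::] (rev s) u; rewrite revK /= catA.
Qed.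

Lemma FC_Kword g : FC D g -> Kword g.
Proof.
case=> p [ell [Dp inj ->]]; rewrite -[gred _]cat0s -Kword_gred.
exact: cat_Kword.
Qed.

(** The coset relation: u^-1 v has its word in [D]. *)
Definition fcong (u v : fword) : Prop := Kword (rev (invword u) ++ invword v).

Lemma fcong_refl u : fcong u u.
Proof.
apply: (@Kword_eq [::]); last exact: Kword_nil.
by have := gred_revK [::] (invword u) [::]; rewrite cats0.
Qed.

Lemma fcong_sym u v : fcong u v -> fcong v u.
Proof. by move=> /Kword_rev; rewrite rev_cat revK. Qed.

Lemma fcong_trans v u w : fcong u v -> fcong v w -> fcong u w.
Proof.
move=> Kuv Kvw; apply: Kword_eq (Kword_mul Kuv Kvw).
have := gred_revK (rev (invword u)) (rev (invword v)) (invword w).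
by rewrite revK -!catA.
Qed.

(** This is normality: the word of u^-1 u' is conjugated by that of [v], then multiplied by the word
    of v^-1 v'. *)
Lemma fcong_cat u u' v v' :
  fcong u u' -> fcong v v' -> fcong (u ++ v) (u' ++ v').
Proof.
rewrite /fcong !invword_cat rev_cat => /(Kword_conj (invword v)) Ku Kv.
apply: Kword_eq (Kword_mul Ku Kv).
have := gred_revK (rev (invword v) ++ rev (invword u) ++ invword u')
  (rev (invword v)) (invword v').
by rewrite revK -!catA.
Qed.

Lemma fcong_inv u v : fcong u v -> fcong (finv u) (finv v).
Proof.
rewrite /fcong !invword_inv revK => /Kword_rev.
by rewrite rev_cat revK; apply: Kword_rot.
Qed.

Lemma fcong_mulV u : fcong (finv u ++ u) [::].
Proof.
rewrite /fcong invword_cat invword_inv cats0; apply: Kword_rev.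
exact: fcong_refl.
Qed.

End CategoryWords.

(** * The quotient group of a category *)

Section Quotient.
Variable R : fword -> fword -> Prop.
Hypothesis R_refl : forall u, R u u.
Hypothesis R_sym : forall u v, R u v -> R v u.
Hypothesis R_trans : forall v u w, R u v -> R v w -> R u w.
Hypothesis R_cat : forall u u' v v', R u u' -> R v v' -> R (u ++ v) (u' ++ v').
Hypothesis R_inv : forall u v, R u v -> R (finv u) (finv v).
Hypothesis R_mulV : forall u, R (finv u ++ u) [::].

Definition qrep (u : fword) : fword := epsilon (inhabits [::]) (R u).

Lemma qrepP u : R u (qrep u).
Proof. by apply: epsilon_spec; exists u. Qed.

(** Equivalent words define equal predicates by extensionality, so the choice operator returns the
    same representative. *)
Lemma qrep_eq u v : R u v -> qrep u = qrep v.
Proof.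
move=> Ruv; congr (epsilon _ _); apply: functional_extensionality => w.
apply: propositional_extensionality.
by split; apply: R_trans => //; apply: R_sym.
Qed.

Lemma qrep_idem u : qrep (qrep u) == qrep u.
Proof. by apply/eqP/qrep_eq/R_sym/qrepP. Qed.

Definition qcar : Type := {u : fword | qrep u == u}.

Definition qclass (u : fword) : qcar := exist _ (qrep u) (qrep_idem u).

Lemma qclassP u v : qclass u = qclass v <-> R u v.
Proof.
split=> [/(congr1 val) /= e | Ruv]; last by apply: val_inj; apply: qrep_eq.
by apply: (R_trans (qrepP u)); rewrite e; apply/R_sym/qrepP.
Qed.

Lemma qclass_val (x : qcar) : qclass (val x) = x.
Proof. by apply: val_inj; apply/eqP/(valP x). Qed.

Lemma R_val u : R (val (qclass u)) u.
Proof. exact/R_sym/qrepP. Qed.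

Definition qmul (x y : qcar) : qcar := qclass (val x ++ val y).
Definition qinv (x : qcar) : qcar := qclass (finv (val x)).

Lemma qmulA x y z : qmul x (qmul y z) = qmul (qmul x y) z.
Proof.
apply/qclassP; apply: (@R_trans (val x ++ val y ++ val z)).
  by apply: R_cat => //; apply: R_val.
by rewrite catA; apply: R_cat => //; apply/R_sym/R_val.
Qed.

Lemma qmul1 x : qmul (qclass [::]) x = x.
Proof.
rewrite -[RHS]qclass_val; apply/qclassP.
by apply: (@R_cat _ [::] _ (val x)) => //; apply: R_val.
Qed.

Lemma qmulV x : qmul (qinv x) x = qclass [::].
Proof.
apply/qclassP; apply: R_trans (R_mulV (val x)).
by apply: R_cat => //; apply: R_val.
Qed.

Definition quot_group : group := Group qmulA qmul1 qmulV.

Lemma geval_quot (g : nat -> quot_group) sigma w :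
  (forall k, g k = qclass (sigma k)) -> geval g w = qclass (wsubst sigma w).
Proof.
move=> gs; elim: w => // -[k b] w IH; rewrite geval_cons IH /gletter /= gs.
apply/qclassP; apply: R_cat; last exact: R_val.
case: b => /=; last exact: R_val.
by apply: (R_trans (R_val _)); apply/R_inv/R_val.
Qed.

Lemma geval_quot_gen w :
  @geval quot_group (fun k => qclass (gen k)) w = qclass w.
Proof.
rewrite (geval_quot w (sigma := gen)) //; congr qclass.
by elim: w => // -[k []] w; rewrite /wsubst /= => ->.
Qed.

(** Every family in the quotient is represented by words, so testing substitution instances of [w]
    suffices. *)
Lemma identical_quot w :
  (forall sigma, R (wsubst sigma w) [::]) -> identical w quot_group.
Proof.
move=> Rw g; rewrite (geval_quot w (sigma := fun k => val (g k))).
  exact/qclassP.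
by move=> k; rewrite qclass_val.
Qed.

End Quotient.

(** * The lattice embedding *)

(** Membership is decided by the reduced word, so [IdV V] determines the category; this is where
    injectivity of F enters. *)
Lemma CV_memP V C p : is_CV V C ->
  C p <-> wf_part p /\ exists w, IdV V w /\ gred (pword p id) = phi w.
Proof.
case=> -[catC Cb4 Crho _] FCE; split=> [Cp | [wfp ex]].
  split; first exact: cat_wf Cp.
  by apply/FCE; exists p, id; split.
apply: (Kword_cat catC wfp); have /FCE /(FC_Kword catC Cb4 Crho) := ex.
by move=> K; apply/(Kword_gred catC Cb4 Crho [::]).
Qed.

Lemma CV_phiP V C w : is_CV V C -> FC C (phi w) -> freduced w -> IdV V w.
Proof. by case=> _ FCE /FCE[w' [Iw' e]] rw; apply: IdV_phi e. Qed.

Lemma FC_sub (C C' : part -> Prop) g :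
  (forall p, C p -> C' p) -> FC C g -> FC C' g.
Proof.
by move=> sub [p [ell [Cp inj ->]]]; exists p, ell; split=> //; apply: sub.
Qed.

Lemma IdV_sub (V V' : group -> Prop) w :
  (forall G, V G -> V' G) -> IdV V' w -> IdV V w.
Proof. by move=> sub [rw h]; split=> // G /sub; apply: h. Qed.

Lemma CV_sub V V' C C' : is_CV V C -> is_CV V' C' ->
  (forall w, IdV V w -> IdV V' w) -> forall p, C p -> C' p.
Proof.
move=> CV CV' sub p /(CV_memP _ CV)[wfp [w [Iw e]]].
by apply/(CV_memP _ CV'); split=> //; exists w; split=> //; apply: sub.
Qed.

Lemma IdV_vjoin V1 V2 w : IdV (vjoin V1 V2) w <-> IdV V1 w /\ IdV V2 w.
Proof.
split=> [Iw|[I1 I2]]; last by split=> [|G]; [case: I1 | apply].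
split; apply: IdV_sub Iw => G VG v [_ h1] [_ h2]; [exact: h1|exact: h2].
Qed.

Definition cat_group (D : part -> Prop)
    (catD : category D) (Db4 : D b4) (Drho : D rho) : group :=
  quot_group (fcong_refl catD Db4 Drho) (@fcong_sym _ catD)
    (@fcong_trans _ catD Db4 Drho) (@fcong_cat _ catD Db4 Drho)
    (fcong_mulV catD Db4 Drho).

Lemma identical_cat_group (D : part -> Prop)
    (catD : category D) (Db4 : D b4) (Drho : D rho) w :
  identical w (cat_group catD Db4 Drho) -> Kword D (invword w).
Proof.
move/(_ (fun k => qclass (fcong_refl catD Db4 Drho) (@fcong_sym _ catD)
                    (@fcong_trans _ catD Db4 Drho) (gen k))).
rewrite /cat_group geval_quot_gen.
  by move=> /qclassP /(fcong_sym catD).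
exact: fcong_inv.
Qed.

(** Substitution instances of the defining identities are again identities of [V], so their words
    lie in [C], hence in [D], and they become trivial in the quotient. *)
Lemma variety_quot V C D (catD : category D) (Db4 : D b4) (Drho : D rho) :
  variety V -> is_CV V C -> (forall p, C p -> D p) ->
  V (cat_group catD Db4 Drho).
Proof.
case=> W WE [_ FCE] sub; apply/WE => w Ww; apply: identical_quot => [|sigma].
  exact: fcong_inv.
have Iw : IdV V (fred (wsubst sigma w)).
  by apply: IdV_wsubst => G /WE; apply.
apply: fcong_sym => //; rewrite /fcong /=.
have : FC D (phi (fred (wsubst sigma w))).
  by apply: FC_sub sub _; apply/FCE; exists (fred (wsubst sigma w)).
rewrite phi_fred phiE => /(FC_Kword catD Db4 Drho) K.
exact/(Kword_gred catD Db4 Drho [::]).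
Qed.

Theorem mainTheorem12 :
  (forall V : group -> Prop, variety V -> nontrivialV V ->
     [/\ fproper (IdV V), S_invariant (IdV V) & exists C, is_CV V C]) /\
  (forall (V1 V2 : group -> Prop) (C1 C2 : part -> Prop),
     variety V1 -> variety V2 -> nontrivialV V1 -> nontrivialV V2 ->
     is_CV V1 C1 -> is_CV V2 C2 ->
     [/\ ((forall G, V1 G -> V2 G) <-> (forall p, C2 p -> C1 p)),
         (forall C, is_CV (vjoin V1 V2) C -> forall p, C p <-> C1 p /\ C2 p) &
         (nontrivialV (vmeet V1 V2) -> forall C, is_CV (vmeet V1 V2) C ->
            (forall p, C1 p \/ C2 p -> C p) /\
            (forall D, category D -> (forall p, C1 p \/ C2 p -> D p) ->
               forall p, C p -> D p))]).
Proof.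
split=> [V _ nV | V1 V2 C1 C2 var1 var2 _ _ CV1 CV2].
  split; [exact: IdV_proper | exact: IdV_S_invariant |].
  by exists (word_cat (trivial_word V)); apply: trivial_word_is_CV.
split.
- split=> [sub | sub G V1G].
    by apply: (CV_sub CV2 CV1) => w; apply: IdV_sub.
  (* A defining identity of [V2] gives an element of F([C2]), hence of F([C1]), and is therefore an
     identity of [V1]. *)
  case: (var2) => W2 W2E; apply/W2E => w Ww g; rewrite -geval_red.
  have [_ h] : IdV V1 (fred w); last exact: h.
  apply: (CV_phiP CV1); last exact: fred_reduced.
  apply: FC_sub sub _; apply/(proj2 CV2); exists (fred w); split=> //.
  by apply: IdV_fred => H /W2E; apply.
- move=> C CV p; split=> [Cp | [/(CV_memP _ CV1)[wfp [w1 [I1 e1]]]]].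
    by split; [apply: (CV_sub CV CV1) Cp | apply: (CV_sub CV CV2) Cp]
      => w /IdV_vjoin[].
  case/(CV_memP _ CV2) => _ [w2 [I2 e2]]; apply/(CV_memP _ CV); split=> //.
  (* [w1] and [w2] have the same image under [phi], so [w1] is an identity of both varieties. *)
  exists w1; split=> //; apply/IdV_vjoin; split=> //.
  by apply: (IdV_phi (proj1 I1) I2); rewrite -e1.
- move=> _ C CV; split=> [p [] | D catD sub p Cp].
  + by apply: (CV_sub CV1 CV) => w; apply: IdV_sub => G [].
  + by apply: (CV_sub CV2 CV) => w; apply: IdV_sub => G [].
  have Db4 : D b4 by case: CV1 => -[_ ? _ _] _; apply: sub; left.
  have Drho : D rho by case: CV1 => -[_ _ ? _] _; apply: sub; left.
  (* The quotient by the words of [D] lies in both varieties, so it satisfies every identity of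
     their intersection. *)
  have V1q := variety_quot catD Db4 Drho var1 CV1
    (fun p h => sub p (or_introl h)).
  have V2q := variety_quot catD Db4 Drho var2 CV2
    (fun p h => sub p (or_intror h)).
  case/(CV_memP _ CV): Cp => wfp [w [[_ Iw] e]].
  apply: (Kword_cat catD wfp).
  apply: (Kword_eq catD Db4 Drho (esym e)); apply: identical_cat_group.
  exact: Iw _ (conj V1q V2q).
Qed.
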